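(* Let $k\ge 2$ and $m_1\le m_2\le\dots\le m_k$ be positive integers. Let $r$ be the largest integer such that $m_1\ge 4q^k\left(\frac{k}{k-1}\right)^r$, where $q=\left\lceil \frac{k}{k-1}r^2\right\rceil$. If $m_i\in\left[4q^k\left(\frac{k}{k-1}\right)^r,\ \binom{q}{r}q^{(i-1)r+(k-i)}\right]$ for all $1\le i\le k$, then $\chi_{\ell}(K_{m_1,m_2,\dots,m_k},1)>r$.
   Context: $K_{m_1,\dots,m_k}$ is the complete multipartite graph with $k$ partite sets of sizes $m_1,\dots,m_k$. For a graph $G$, a list $L$ assigns to each vertex $v$ a set $L(v)$ of colors; $G$ is $L$-colorable if there is a proper coloring $f$ with $f(v)\in L(v)$ for all $v$. $L$ is an $l$-list if $|L(v)|=l$ for all $v$. For a positive integer $s$, $L$ is $s$-separated if $|L(u)\cap L(v)|\le s$ for every edge $uv$; $\chi_{\ell}(G,s)$ is the least $l$ such that $G$ is $L$-colorable from every $s$-separated $l$-list. *)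

(* Defs.v *)
From HB Require Import structures.
From mathcomp Require Import all_boot all_order all_algebra.
From mathcomp Require Import boolp.

Set Implicit Arguments.
Unset Strict Implicit.
Unset Printing Implicit Defensive.

Import Order.TTheory GRing.Theory Num.Theory.

Record sgraph := SGraph {
  vert :> finType;
  adj : rel vert;
  adj_sym : symmetric adj;
  adj_irr : irreflexive adj }.

Section CompleteMultipartite.
Variables (k : nat) (m : 'I_k -> nat).

Definition multipartite_adj : rel {i : 'I_k & 'I_(m i)} :=
  fun u v => tag u != tag v.

Lemma multipartite_sym : symmetric multipartite_adj.
Proof. by move=> u v; rewrite /multipartite_adj eq_sym. Qed.

Lemma multipartite_irr : irreflexive multipartite_adj.
Proof. by move=> u; rewrite /multipartite_adj eqxx. Qed.

Definition complete_multipartite : sgraph :=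
  SGraph multipartite_sym multipartite_irr.

End CompleteMultipartite.

Section ListColoring.
Variable G : sgraph.

Definition list_colorable (C : finType) (L : G -> {set C}) : Prop :=
  exists f : G -> C,
    (forall v, f v \in L v) /\ (forall u v, adj u v -> f u != f v).

Definition is_llist (l : nat) (C : finType) (L : G -> {set C}) : Prop :=
  forall v, #|L v| = l.

Definition separated (s : nat) (C : finType) (L : G -> {set C}) : Prop :=
  forall u v, adj u v -> #|L u :&: L v| <= s.

(* As G is finite, a finite pool of colors (of arbitrary size) contains all
   the lists, so finite color types suffice. *)
Definition sep_choosable (s l : nat) : Prop :=
  forall (C : finType) (L : G -> {set C}),
    is_llist l L -> separated s L -> list_colorable L.

Lemma greedy_colorable (C : finType) (L : G -> {set C}) :
  is_llist #|G| L -> list_colorable L.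
Proof.
move=> hL.
have H (s : seq G) : uniq s -> exists g : G -> option C,
    (forall v, v \in s -> exists2 c, g v = Some c & c \in L v) /\
    {in s &, forall u v, u != v -> g u != g v}.
  elim: s => [|x s IH] /=; first by move=> _; exists (fun=> None); split.
  move=> /andP[xs us]; have [g [g1 g2]] := IH us.
  pose A := [set c in L x | Some c \notin map g s].
  have [c] : exists c, c \in A.
    apply/set0Pn; apply/negP => /eqP A0.
    have sub : {subset map Some (enum (L x)) <= map g s}.
      move=> _ /mapP[c + ->]; rewrite mem_enum => cL.
      by apply/negPn/negP => h; have := in_set0 c; rewrite -A0 inE cL h.
    have := uniq_leq_size _ sub; rewrite !size_map -cardE hL.
    rewrite map_inj_uniq ?enum_uniq; last by move=> ? ? [].
    move=> /(_ isT); apply/negP; rewrite -ltnNge.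
    have /card_uniqP /= <- : uniq (x :: s) by rewrite /= xs us.
    exact: max_card.
  rewrite inE => /andP[cL cN].
  exists (fun v => if v == x then Some c else g v); split.
    move=> v; rewrite inE; case: eqP => [-> _|_ /= vs]; first by exists c.
    exact: g1.
  move=> u v; rewrite !inE; case: eqP => [->|_]; case: eqP => [->|_] //=.
  - by rewrite eqxx.
  - by move=> _ vs _; apply: contraNneq cN => ->; apply: map_f.
  - by move=> us' _ _; apply: contraNneq cN => <-; apply: map_f.
  - exact: g2.
have [g [g1 g2]] := H (enum G) (enum_uniq _).
have gE v : exists c, g v = Some c /\ c \in L v.
  by have [|c ? ?] := g1 v; [rewrite mem_enum | exists c].
have [f fP] := choice gE.
exists f; split=> [v|u v uv]; first by have [] := fP v.
have nuv : u != v by apply: contraTneq uv => ->; rewrite adj_irr.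
have := g2 u v; rewrite !mem_enum => /(_ isT isT nuv).
by have [-> _] := fP u; have [-> _] := fP v.
Qed.

Lemma ex_sep_choosable (s : nat) : exists l, `[< sep_choosable s l >].
Proof. by exists #|G|; apply/asboolP => C L hL _; apply: greedy_colorable. Qed.

Definition sep_choice_number (s : nat) : nat := ex_minn (ex_sep_choosable s).

End ListColoring.

Local Open Scope ring_scope.

Definition qceil (k r : nat) : nat :=
  `|Num.ceil ((k%:R / (k%:R - 1)) * r%:R ^+ 2 : rat)|%N.

Definition lower_bound (k r : nat) : rat :=
  4 * (qceil k r)%:R ^+ k * (k%:R / (k%:R - 1)) ^+ r.

(* The parts are numbered by 'I_k, so i stands for the index i.+1 of the
   formula binom(q, r) q^((i-1)r + (k-i)) with i in 1..k. *)
Definition upper_bound (k r i : nat) : nat :=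
  ('C(qceil k r, r) * qceil k r ^ (i * r + (k - i.+1)))%N.

(* Main.v *)
Require Import Defs.
From HB Require Import structures.
From mathcomp Require Import all_boot all_order all_algebra.
From mathcomp Require Import ring lra.

Set Implicit Arguments.
Unset Strict Implicit.
Unset Printing Implicit Defensive.

Import Order.TTheory GRing.Theory Num.Theory.
Local Open Scope ring_scope.

(* Take the colors to be the vectors of [q]^k. A list of part i consists of r
   vectors that agree in the coordinates > i, have distinct i-th coordinates and
   are arbitrary in the coordinates < i; lists of different parts then share at
   most one color. A proper coloring induces a map phi from colors to parts such
   that every list of part i contains a color of phi^-1(i). For fixed phi let p_i
   be the probability that a random list of part i misses phi^-1(i). Convexity
   of the falling factorial, together with q (k-1)/k >= r^2, gives
   p_1 + ... + p_k >= (k/2) ((k-1)/k)^r =: P, so a random choice of one list per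
   part is hit everywhere by phi with probability at most 1/(1+P). Choosing such
   rounds greedily, each divides the number of surviving maps phi by 1+P, and
   4 q^k (k/(k-1))^r rounds eliminate all k^(q^k) of them. *)

(** * Truncated falling factorials and a product inequality *)

Section FallingFactorial.
Variable R : realFieldType.
Implicit Types (S : R) (n : nat).

(** The falling factorial [S (S-1) ... (S-n+1)] with every factor cut off at 0, which makes it
    nonnegative and nondecreasing on all of [R]. *)
Definition pos_ffact n S : R := \prod_(j < n) Num.max 0 (S - j%:R).

Lemma pos_ffactS n S :
  pos_ffact n.+1 S = pos_ffact n S * Num.max 0 (S - n%:R).
Proof. by rewrite /pos_ffact big_ord_recr. Qed.

Lemma pos_ffact_ge0 n S : 0 <= pos_ffact n S.
Proof. by apply: prodr_ge0 => j _; rewrite le_max lexx. Qed.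

Lemma pos_ffact_mono n : {homo pos_ffact n : S T / S <= T}.
Proof.
move=> S T leST; apply: ler_prod => j _; rewrite le_max lexx /=.
by rewrite ge_max !le_max lexx /= lerD2r leST orbT.
Qed.

(* If F and G are nondecreasing then (F S - F S0) * (G S - G S0) >= 0, so a
   product of two such functions inherits supporting lines. *)
Lemma pos_ffact_support n (S0 : R) : n%:R <= S0 ->
  exists D : R, forall S, pos_ffact n S0 + D * (S - S0) <= pos_ffact n S.
Proof.
elim: n => [|n IHn] leS0.
  by exists 0 => S; rewrite mul0r addr0 /pos_ffact !big_ord0.
have leS0' : n%:R <= S0 by apply: le_trans leS0; rewrite ler_nat.
have [D HD] := IHn leS0'.
(* The slope follows the product rule: the new factor has slope 1 and value [S0 - n] at [S0]. *)
exists (D * (S0 - n%:R) + pos_ffact n S0) => S; rewrite !pos_ffactS.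
have g0E : Num.max 0 (S0 - n%:R) = S0 - n%:R by apply/max_idPr; rewrite subr_ge0.
have gS : S - n%:R <= Num.max 0 (S - n%:R) by rewrite le_max lexx orbT.
rewrite g0E; have := HD S; have F0 := pos_ffact_ge0 n S0.
set g := Num.max _ _ in gS *; set F := pos_ffact n S; set F1 := pos_ffact n S0.
rewrite -/F1 in F0 * => HF.
have cheb : 0 <= (F - F1) * (g - (S0 - n%:R)).
  have [leS|/ltW leS] := leP S S0.
    apply: mulr_le0; first by rewrite subr_le0 pos_ffact_mono.
    by rewrite subr_le0 /g ge_max lerD2r leS subr_ge0 leS0'.
  apply: mulr_ge0; first by rewrite subr_ge0 pos_ffact_mono.
  by rewrite subr_ge0 /g le_max lerD2r leS orbT.
have h1 : 0 <= F1 * (g - (S - n%:R)) by rewrite mulr_ge0 ?subr_ge0.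
have h2 : 0 <= (S0 - n%:R) * (F - (F1 + D * (S - S0))).
  by rewrite mulr_ge0 ?subr_ge0.
nra.
Qed.

(** Since [(S - j)/(T - j) >= (S/T)(1 - j/S)], the loss beyond [(S/T)^n] is about [1 - n^2/(2S)],
    and this is at least [1/2] when [n^2 <= S]. The induction carries [1 - i^2/(2S)] in place of
    [1/2]. *)
Lemma pos_ffact_ge n S (T : R) : 0 < S -> (n * n)%:R <= S -> S <= T ->
  (S / T) ^+ n / 2 * (\prod_(j < n) (T - j%:R)) <= pos_ffact n S.
Proof.
move=> S0 nS ST; have T0 : 0 < T by apply: lt_le_trans ST.
have ltj (j : nat) : (j < n)%N -> j%:R < S.
  move=> jn; apply: lt_le_trans nS; rewrite ltr_nat.
  by apply: (leq_trans jn); rewrite leq_pmull //; apply: leq_trans jn.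
have H i : (i <= n)%N -> (S / T) ^+ i * (1 - (i * i)%:R / (2 * S))
    * \prod_(j < i) (T - j%:R) <= pos_ffact i S.
  elim: i => [_|i IHi ltin].
    by rewrite /pos_ffact !big_ord0 mul0r subr0 mul1r mulr1 lexx.
  rewrite pos_ffactS big_ord_recr /=.
  have iS := ltj _ ltin; set u := (S / T) ^+ i; set Q := \prod_(j < i) _.
  have -> : Num.max 0 (S - i%:R) = S - i%:R.
    by apply/max_idPr; rewrite subr_ge0 ltW.
  apply: le_trans (ler_wpM2r _ (IHi (ltnW ltin))); last by rewrite subr_ge0 ltW.
  have Q0 : 0 <= Q.
    apply: prodr_ge0 => j _; rewrite subr_ge0; apply: le_trans ST; apply: ltW.
    by apply: ltj; apply: ltn_trans ltin.
  have u0 : 0 <= u by rewrite exprn_ge0 // divr_ge0 ?ltW.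
  rewrite exprS -/u -/Q.
  have -> : S / T * u * (1 - (i.+1 * i.+1)%:R / (2 * S)) * (Q * (T - i%:R))
     = u * Q * ((1 - (i.+1 * i.+1)%:R / (2 * S)) * (S * (T - i%:R) / T)) by ring.
  have -> : u * (1 - (i * i)%:R / (2 * S)) * Q * (S - i%:R)
     = u * Q * ((1 - (i * i)%:R / (2 * S)) * (S - i%:R)) by ring.
  apply: ler_wpM2l; first exact: mulr_ge0.
  have a0 : 0 <= (1 - (i.+1 * i.+1)%:R / (2 * S)).
    rewrite subr_ge0 ler_pdivrMr ?mulr_gt0 // mul1r.
    apply: le_trans (_ : (n * n)%:R <= _); last by lra.
    by rewrite ler_nat leq_mul.
  apply: le_trans (_ : (1 - (i.+1 * i.+1)%:R / (2 * S)) * S <= _).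
    apply: ler_wpM2l => //; rewrite ler_pdivrMr // ler_pM2l //.
    by rewrite gerBl.
  have -> : (1 - (i.+1 * i.+1)%:R / (2 * S)) * S = S - (i.+1 * i.+1)%:R / 2.
    by field; rewrite gt_eqF.
  have -> : (1 - (i * i)%:R / (2 * S)) * (S - i%:R)
    = S - i%:R - (i * i)%:R / 2 + (i * i * i)%:R / (2 * S).
    by rewrite !natrM; field; rewrite gt_eqF.
  rewrite !natrM -natr1.
  have : 0 <= (i%:R * i%:R * i%:R) / (2 * S).
    by rewrite divr_ge0 ?mulr_ge0 // ltW.
  lra.
apply: le_trans (H n (leqnn n)).
apply: ler_wpM2r.
  apply: prodr_ge0 => j _; rewrite subr_ge0; apply: le_trans ST; apply: ltW.
  exact: ltj.
apply: ler_wpM2l; first by rewrite exprn_ge0 // divr_ge0 ?ltW.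
rewrite lerBrDl -lerBrDr ler_pdivrMr ?mulr_gt0 //; lra.
Qed.

(** Independent events of total probability P all fail with probability at most [1/(1+P)]. *)
Lemma prod1B_mul1D_le1 (I : Type) (s : seq I) (p : I -> R) :
  (forall i, 0 <= p i <= 1) ->
  (\prod_(i <- s) (1 - p i)) * (1 + \sum_(i <- s) p i) <= 1.
Proof.
move=> p01.
have H : 0 <= \prod_(i <- s) (1 - p i) /\ 0 <= \sum_(i <- s) p i.
  split; [apply: prodr_ge0 | apply: sumr_ge0] => i _; have := p01 i; lra.
elim: s H => [|i s IHs]; first by rewrite !big_nil; lra.
have Hs : 0 <= \prod_(i <- s) (1 - p i) /\ 0 <= \sum_(i <- s) p i.
  split; [apply: prodr_ge0 | apply: sumr_ge0] => j _; have := p01 j; lra.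
move=> _; rewrite !big_cons; have := IHs Hs; case: Hs.
set Q := \prod_(_ <- _) _; set Z := \sum_(_ <- _) _ => Q0 Z0 QZ.
apply: le_trans QZ; have /andP[pi0 pi1] := p01 i.
have -> : (1 - p i) * Q * (1 + (p i + Z)) =
  Q * (1 + Z) - Q * (p i * (p i + Z)) by ring.
by rewrite gerBl !mulr_ge0 ?addr_ge0.
Qed.

End FallingFactorial.

(** * Weighted counts of injections *)

Section InjectiveSums.
Variables (R : realFieldType) (T : finType) (x : T -> R).
Hypothesis x01 : forall a, 0 <= x a <= 1.

Lemma sum_inj_ffunS n (F : T -> {ffun 'I_n -> T} -> R) :
  \sum_(f : {ffun 'I_n.+1 -> T} | injectiveb f)
    F (f ord0) [ffun j => f (lift ord0 j)]
  = \sum_(g : {ffun 'I_n -> T} | injectiveb g)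
      \sum_(a | a \notin codom g) F a g.
Proof.
rewrite pair_big_dep /=.
pose h (p : {ffun 'I_n -> T} * T) : {ffun 'I_n.+1 -> T} :=
  [ffun j => oapp p.1 p.2 (unlift ord0 j)].
pose h' (f : {ffun 'I_n.+1 -> T}) := ([ffun j => f (lift ord0 j)], f ord0).
rewrite (reindex h) /=; last first.
  exists h' => [[g a] _|f _].
    rewrite /h' /h !ffunE unlift_none /=; congr (_, _).
    by apply/ffunP => j; rewrite !ffunE liftK.
  by apply/ffunP => j; rewrite /h !ffunE; case: unliftP => [j'|] -> /=; rewrite ?ffunE.
apply: eq_big => [[g a]|[g a] _] /=; last first.
  rewrite /h !ffunE unlift_none /=; congr (F _ _).
  by apply/ffunP => j; rewrite !ffunE liftK.
apply/injectiveP/andP => [inj|[/injectiveP inj /negP aN]].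
  split.
    apply/injectiveP => j j' e; apply: (@lift_inj _ ord0); apply: inj.
    by rewrite !ffunE !liftK /= e.
  apply/negP => /codomP[j e]; have /eqP := neq_lift ord0 j; apply.
  by apply: inj; rewrite !ffunE unlift_none liftK.
move=> j j'; rewrite !ffunE; case: unliftP => [i|] ->; case: unliftP => [i'|] -> //=.
- by move/inj ->.
- by move=> e; case: aN; rewrite -e codom_f.
- by move=> e; case: aN; rewrite e codom_f.
Qed.

(** An injection with n values extends by any a outside its image. The image has total weight at
    most n because [x <= 1], so the extensions contribute a factor of at least [max 0 (S - n)],
    where S is the total weight. *)
Lemma sum_inj_prod_ge n :
  pos_ffact n (\sum_a x a) <=
  \sum_(f : {ffun 'I_n -> T} | injectiveb f) \prod_j x (f j).
Proof.
have x0 a : 0 <= x a by have /andP[] := x01 a.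
have x1 a : x a <= 1 by have /andP[] := x01 a.
elim: n => [|n IHn].
  rewrite /pos_ffact big_ord0.
  (* The empty function, whose empty product already gives the value 1. *)
  rewrite (bigD1 [ffun i : 'I_0 => let: Ordinal i h := i in
            False_rect T (Bool.diff_false_true h)]) /=.
    by rewrite big_ord0 lerDl sumr_ge0 // => f _; rewrite prodr_ge0.
  by apply/injectiveP => -[].
rewrite pos_ffactS.
pose F a (g : {ffun 'I_n -> T}) := x a * \prod_j x (g j).
rewrite (eq_bigr (fun f : {ffun _} => F (f ord0) [ffun j => f (lift ord0 j)])); last first.
  move=> f _; rewrite big_ord_recl /F; congr (_ * _).
  by apply: eq_bigr => j _; rewrite ffunE.
rewrite sum_inj_ffunS.
apply: le_trans (ler_wpM2r _ IHn) _; first by rewrite le_max lexx.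
rewrite mulr_suml; apply: ler_sum => g /injectiveP inj.
rewrite /F -mulr_suml mulrC; apply: ler_wpM2r; first by rewrite prodr_ge0.
rewrite ge_max sumr_ge0 //= lerBlDr.
rewrite (bigID (mem (codom g))) /= addrC lerD2l.
apply: le_trans (_ : \sum_(a in codom g) 1 <= _); first exact: ler_sum.
by rewrite sumr_const card_codom // card_ord.
Qed.

End InjectiveSums.

(** * Growth estimates for the number of rounds *)

Lemma bernoulli (R : realFieldType) (x : R) n : 0 <= x ->
  1 + n%:R * x <= (1 + x) ^+ n.
Proof.
move=> x0; elim: n => [|n IHn]; first by rewrite mul0r addr0 expr0.
rewrite exprS; apply: le_trans (ler_wpM2l _ IHn); last by rewrite addr_ge0.
have : 0 <= n%:R * x * x by rewrite !mulr_ge0.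
rewrite -natr1; nra.
Qed.

(** Let x be [k/(2t)] and n the ceiling of t, so that [t <= n <= 2t]. By Bernoulli
    [(1+x)^n >= 1 + k/2], whose square exceeds k. Hence [2nN] factors suffice, and
    [2nN <= 4Nt <= M]. *)
Lemma exp_lt_exp1D (R : archiRealFieldType) (k N M : nat) (t : R) :
  (0 < N)%N -> 1 <= t -> 4 * N%:R * t <= M%:R ->
  k%:R ^+ N < (1 + k%:R / (2 * t)) ^+ M.
Proof.
move=> N0 t1 tM; have t0 : 0 < t by apply: lt_le_trans t1.
have [n tn nt] : exists2 n : nat, t <= n%:R & n%:R <= 2 * t.
  exists `|Num.ceil t|%N; have c0 : 0 <= Num.ceil t by rewrite ceil_ge0; lra.
    by rewrite natr_absz ger0_norm // ceil_ge.
  rewrite natr_absz ger0_norm //; have := ceilB1_lt t; rewrite intrB /=; lra.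
set x := k%:R / _; have x0 : 0 <= x by rewrite divr_ge0 // mulr_ge0 // ltW.
have MN : (2 * n * N <= M)%N.
  rewrite -(ler_nat R) !natrM; apply: le_trans tM.
  have : 0 <= N%:R * (2 * t - n%:R) by rewrite mulr_ge0 ?subr_ge0.
  nra.
apply: lt_le_trans (_ : (1 + x) ^+ (2 * n * N) <= _); last first.
  by apply: ler_weXn2l => //; rewrite lerDl.
rewrite exprM ltr_pXn2r ?nnegrE ?exprn_ge0 ?addr_ge0 //.
have nx : k%:R / 2 <= n%:R * x.
  rewrite /x mulrA ler_pdivlMr ?mulr_gt0 //.
  have -> : k%:R / 2 * (2 * t) = k%:R * t by field.
  by rewrite mulrC ler_wpM2r.
have := bernoulli n x0 => B.
rewrite mulnC exprM; apply: lt_le_trans (_ : (1 + k%:R / 2) ^+ 2 <= _).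
  have : 0 <= k%:R :> R by []. rewrite expr2; nra.
by rewrite lerXn2r ?nnegrE ?addr_ge0 ?divr_ge0 ?exprn_ge0 //; lra.
Qed.

(** * Random lists of colors in [[q]^k] *)

Section Lists.
Variables k q r : nat.

Local Notation color := {ffun 'I_k -> 'I_q}.

Definition mix (i : 'I_k) (c : color) (a : 'I_q) (b : color) : color :=
  [ffun l : 'I_k => if (l < i)%N then c l else if l == i then a else b l].

Lemma mix_at i c a b : mix i c a b i = a.
Proof. by rewrite ffunE ltnn eqxx. Qed.

Lemma mix_gt (i l : 'I_k) c a b : (i < l)%N -> mix i c a b l = b l.
Proof.
move=> il; rewrite ffunE ltnNge (ltnW il) /=.
by case: eqP => // e; rewrite e ltnn in il.
Qed.

Local Notation sample :=
  (color * {ffun 'I_r -> 'I_q} * {ffun 'I_r -> color})%type.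

(** A sample holds the common tail b, the r values at coordinate i and the r heads. Tails and heads
    are stored as full vectors, with surplus entries ignored, so that one sample space serves all
    parts. *)
Definition sample_list (i : 'I_k) (w : sample) : {set color} :=
  [set mix i (w.2 j) (w.1.2 j) w.1.1 | j : 'I_r].

Definition samples : {set sample} := [set w : sample | injectiveb w.1.2].

Lemma card_sample_list i w : w \in samples -> #|sample_list i w| = r.
Proof.
rewrite inE => /injectiveP inj; rewrite card_imset ?card_ord // => j j' e.
by apply: inj; have := congr1 (fun x : color => x i) e; rewrite !mix_at.
Qed.

(* All colors of a list of part i agree in every coordinate l > i, while those
   of a list of part l differ in coordinate l. *)
Lemma sample_list_separated (i l : 'I_k) (w v : sample) :
  v \in samples -> (i < l)%N -> (#|sample_list i w :&: sample_list l v| <= 1)%N.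
Proof.
rewrite inE => /injectiveP inj il; apply/card_le1P => x.
rewrite inE => /andP[/imsetP[j _ xE] /imsetP[j' _ xE']] y.
rewrite in_setI inE; apply/idP/idP; last first.
  by move=> /eqP ->; apply/andP; split; apply/imsetP; [exists j | exists j'].
move=> /andP[/imsetP[h _ yE] /imsetP[h' _ yE']].
have : y l = x l by rewrite yE xE !mix_gt.
by rewrite yE' xE' !mix_at => /inj ->.
Qed.

Lemma card_samples : #|samples| = (q ^ k * q ^_ r * (q ^ k) ^ r)%N.
Proof.
have -> : samples = setX (setX [set: color]
    [set f : {ffun 'I_r -> 'I_q} | injectiveb f]) [set: {ffun 'I_r -> color}].
  by apply/setP => -[[b a] c]; rewrite !inE andbT.
by rewrite !cardsX !cardsT card_inj_ffuns !card_ffun !card_ord.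
Qed.

(* The pair (mix, c i) and the entries of b and c that mix forgets determine
   (b, a, c), so mix is equidistributed. *)
Lemma sum_mix (V : nmodType) (i : 'I_k) (F : color -> V) :
  \sum_(b : color) \sum_(a : 'I_q) \sum_(c : color) F (mix i c a b) =
  (\sum_x F x) *+ (q ^ k * q).
Proof.
rewrite pair_big pair_big /=.
(* The first component keeps the entries that [mix] forgets: those of b up to i and those of c after
   i. The same formula undoes the exchange. *)
pose tau (t : color * 'I_q * color) : color * 'I_q * color :=
  (mix i t.1.1 (t.1.1 i) t.2, t.2 i, mix i t.2 t.1.2 t.1.1).
have tauK : involutive tau.
  move=> [[b a] c]; rewrite /tau /=; congr (_, _, _).
  - apply/ffunP => l; rewrite !ffunE ltnn eqxx.
    by case: ltnP => // _; case: eqP => [->|].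
  - by rewrite mix_at.
  - apply/ffunP => l; rewrite !ffunE.
    by case: ltnP => // _; case: eqP => [->|].
rewrite (reindex tau) /=; last by exists tau => ? _; rewrite tauK.
rewrite (eq_bigr (fun t => F t.2)); last first.
  move=> [[b a] c] _ /=; congr F.
  apply/ffunP => l; rewrite !ffunE.
  by case: ltnP => // _; case: eqP => [->|].
rewrite -(pair_bigA _ (fun _ c => F c)) /= sumr_const.
by rewrite card_prod card_ffun !card_ord.
Qed.

Definition misses (i : 'I_k) (phi : {ffun color -> 'I_k}) : {set sample} :=
  [set w in samples | [forall j, phi (mix i (w.2 j) (w.1.2 j) w.1.1) != i]].

(** The conditional probability, given the tail b and the i-th coordinate a, that a random color of
    the list is not assigned to part i. *)
Definition miss_freq (i : 'I_k) (phi : {ffun color -> 'I_k}) (b : color)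
    (a : 'I_q) : rat :=
  (\sum_(c : color) (phi (mix i c a b) != i)%:R) / (q ^ k)%:R.

(** For a fixed tail and fixed i-th coordinates the r heads are chosen independently, so the sum
    over heads factors. *)
Lemma card_misses i phi : (0 < q)%N ->
  #|misses i phi|%:R = (q ^ k)%:R ^+ r * \sum_(b : color)
    \sum_(f : {ffun 'I_r -> 'I_q} | injectiveb f)
      \prod_j miss_freq i phi b (f j).
Proof.
move=> q0; have Q0 : (q ^ k)%:R != 0 :> rat by rewrite pnatr_eq0 -lt0n expn_gt0 q0.
rewrite mulr_sumr -sum1_card natr_sum.
transitivity (\sum_(b : color) \sum_(f : {ffun 'I_r -> 'I_q} | injectiveb f)
   \sum_(g : {ffun 'I_r -> color})
     \prod_j (phi (mix i (g j) (f j) b) != i)%:R : rat); last first.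
  apply: eq_bigr => b _; rewrite mulr_sumr; apply: eq_bigr => f _.
  rewrite -[in (q ^ k)%:R ^+ r](card_ord r) -prodr_const -big_split /=.
  rewrite -(bigA_distr_bigA (fun j c => (phi (mix i c (f j) b) != i)%:R)) /=.
  by apply: eq_bigr => j _; rewrite /miss_freq mulrC divfK.
rewrite pair_big_dep pair_big_dep /= big_mkcond [RHS]big_mkcond /=.
apply: eq_bigr => -[[b f] g] _; rewrite !inE /= andbT.
case: ifP => [/andP[-> /forallP H]|]; first by rewrite big1 // => j _; rewrite H.
case: (injectiveb f) => //= /negbT; rewrite negb_forall => /existsP[j H].
by rewrite (bigD1 j) //= (negbTE H) mul0r.
Qed.

End Lists.

(** * Greedy choice of the rounds *)

Section Rounds.
Variables k q r : nat.
Hypotheses (k_gt1 : (1 < k)%N) (r_gt0 : (0 < r)%N).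
Local Notation color := {ffun 'I_k -> 'I_q}.
Local Notation sample :=
  (color * {ffun 'I_r -> 'I_q} * {ffun 'I_r -> color})%type.
Local Notation samples := (@samples k q r).
Local Notation misses := (@misses k q r).
Local Notation mean := (q%:R * (k%:R - 1) / k%:R : rat).
Hypothesis q_large : r%:R ^+ 2 <= mean.
Local Notation gain := (k%:R / (2 * (k%:R / (k%:R - 1)) ^+ r) : rat).

Let k_gt0 : 0 < k%:R :> rat.
Proof. by rewrite ltr0n ltnW. Qed.

Let k1_gt0 : 0 < k%:R - 1 :> rat.
Proof. by rewrite subr_gt0 ltr1n. Qed.

Let mean_gt0 : 0 < mean.
Proof. by apply: lt_le_trans q_large; rewrite exprn_gt0 // ltr0n. Qed.

Let r_le_mean : r%:R <= mean.
Proof.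
apply: le_trans q_large.
by rewrite expr2 -natrM ler_nat leq_pmulr.
Qed.

Let mean_le_q : mean <= q%:R.
Proof. by rewrite ler_pdivrMr // ler_wpM2l // gerBl. Qed.

Let r_le_q : (r <= q)%N.
Proof. by rewrite -(ler_nat rat); apply: le_trans mean_le_q. Qed.

Let q_gt0 : (0 < q)%N.
Proof. exact: leq_trans r_le_q. Qed.

Let Q_gt0 : 0 < (q ^ k)%:R :> rat.
Proof. by rewrite ltr0n expn_gt0 q_gt0. Qed.

Let samples_gt0 : 0 < #|samples|%:R :> rat.
Proof. by rewrite card_samples ltr0n !muln_gt0 ffact_gt0 r_le_q !expn_gt0 q_gt0. Qed.

(** By equidistribution of [mix], it suffices that each color is missed by all parts except the one
    assigned to it. Thus the sums of [miss_freq] over a average to [mean] over all pairs (i, b). *)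
Lemma sum_miss_freq (phi : {ffun color -> 'I_k}) :
  \sum_i \sum_b \sum_a miss_freq i phi b a = q%:R * (k%:R - 1) * (q ^ k)%:R.
Proof.
transitivity (\sum_(i < k) q%:R * (\sum_x (phi x != i)%:R : rat)).
  apply: eq_bigr => i _.
  transitivity ((\sum_b \sum_a \sum_c (phi (mix i c a b) != i)%:R)
                  / (q ^ k)%:R : rat).
    by rewrite mulr_suml; apply: eq_bigr => b _; rewrite mulr_suml.
  rewrite (sum_mix i (fun x => (phi x != i)%:R : rat)) -[_ *+ (_ * _)]mulr_natl natrM.
  by field; rewrite gt_eqF.
rewrite -mulr_sumr exchange_big /= -mulrA; congr (_ * _).
rewrite (eq_bigr (fun=> k%:R - 1)) => [|x _].
  by rewrite sumr_const card_ffun !card_ord mulr_natr.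
have -> : k%:R = \sum_(i < k) 1 :> rat by rewrite sumr_const card_ord.
rewrite (bigD1 (phi x)) //= eqxx add0r [in RHS](bigD1 (phi x)) //=.
by rewrite addrC addrK; apply: eq_bigr => i ne; rewrite eq_sym ne.
Qed.

(** Jensen's inequality: by [sum_inj_prod_ge] each pair (i, b) contributes at least [pos_ffact r] of
    its total [miss_freq], and these totals average to [mean]. Then [pos_ffact_ge] compares the
    value at [mean] with [q ^_ r], the number of injections. *)
Lemma sum_miss_prob (phi : {ffun color -> 'I_k}) :
  gain <= \sum_i #|misses i phi|%:R / #|samples|%:R.
Proof.
have [D HD] := pos_ffact_support r_le_mean.
set F0 := pos_ffact r mean in HD.
have H : (q ^ k)%:R ^+ r * (k%:R * (q ^ k)%:R * F0)
    <= \sum_i #|misses i phi|%:R.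
  (* The supporting line at [mean]: its slope terms cancel on summing over i and b. *)
  apply: le_trans (_ : (q ^ k)%:R ^+ r * \sum_i \sum_(b : color)
     (F0 + D * (\sum_a miss_freq i phi b a - mean)) <= _).
    apply: ler_wpM2l; first by rewrite exprn_ge0 // ltW.
    under eq_bigr => i _ do
      rewrite big_split /= sumr_const -mulr_sumr sumrB sumr_const.
    rewrite big_split /= sumr_const -mulr_sumr sumrB sumr_const sum_miss_freq.
    rewrite card_ffun !card_ord -!mulrnA -(mulr_natr F0) -(mulr_natr mean).
    rewrite natrM le_eqVlt; apply/orP; left.
    by apply/eqP; field; rewrite gt_eqF.
  rewrite mulr_sumr; apply: ler_sum => i _; rewrite card_misses //.
  apply: ler_wpM2l; first by rewrite exprn_ge0 // ltW.
  apply: ler_sum => b _; apply: le_trans (HD _) _.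
  apply: sum_inj_prod_ge => a; rewrite /miss_freq divr_ge0 ?sumr_ge0 //=.
  rewrite ler_pdivrMr // mul1r.
  apply: le_trans (_ : \sum_(c : color) 1 <= _).
    by apply: ler_sum => c _; case: (_ != _).
  by rewrite sumr_const card_ffun !card_ord.
rewrite -mulr_suml ler_pdivlMr //; apply: le_trans H.
have := pos_ffact_ge mean_gt0 _ mean_le_q; rewrite -/F0 => /(_ r).
rewrite natrM -expr2 => /(_ q_large).
have -> : \prod_(j < r) (q%:R - j%:R) = (q ^_ r)%:R :> rat.
  rewrite ffact_prod natr_prod; apply: eq_bigr => j _; rewrite natrB //.
  by apply: ltnW; apply: leq_trans r_le_q.
have -> : mean / q%:R = (k%:R / (k%:R - 1))^-1.
  by field; rewrite !gt_eqF // ltr0n.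
rewrite card_samples !natrM (natrX _ (q ^ k)%N r) exprVn.
set t := (k%:R / _) ^+ r => HF.
have t0 : 0 < t by rewrite exprn_gt0 // divr_gt0.
have -> : k%:R / (2 * t) * ((q ^ k)%:R * (q ^_ r)%:R * (q ^ k)%:R ^+ r)
  = (q ^ k)%:R ^+ r * (k%:R * (q ^ k)%:R * (t^-1 / 2 * (q ^_ r)%:R)) :> rat.
  by field; rewrite gt_eqF.
apply: ler_wpM2l; first by rewrite exprn_ge0 // ltW.
by apply: ler_wpM2l => //; rewrite mulr_ge0 // ltW.
Qed.

Definition hits (w : {ffun 'I_k -> sample}) (phi : {ffun color -> 'I_k}) :=
  [forall i, w i \notin misses i phi].

Lemma card_family_rat (F : 'I_k -> {set sample}) :
  #|family (fun i => mem (F i))|%:R = \prod_i #|F i|%:R :> rat.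
Proof. by rewrite card_family foldrE big_map big_enum /= natr_prod. Qed.

(** For fixed phi the parts are sampled independently, so at most a fraction [1/(1+gain)] of all
    rounds hit phi. Double counting the pairs (w, phi) then yields a round w that does at least as
    well as the average. *)
Lemma exists_round (X : {set {ffun color -> 'I_k}}) :
  exists w : {ffun 'I_k -> sample}, (forall i, w i \in samples) /\
    #|[set phi in X | hits w phi]|%:R * (1 + gain) <= #|X|%:R.
Proof.
pose W := [set w : {ffun 'I_k -> sample} | [forall i, w i \in samples]].
have WE : #|W|%:R = #|samples|%:R ^+ k :> rat.
  rewrite -(eq_card (A := family (fun i : 'I_k => mem samples))).
    by rewrite card_family_rat prodr_const card_ord.
  by move=> w; rewrite !inE.
have gain0 : 0 <= gain.
  by rewrite divr_ge0 ?mulr_ge0 ?exprn_ge0 ?divr_ge0 // ltW.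
have Hphi phi : #|[set w in W | hits w phi]|%:R * (1 + gain) <= #|W|%:R.
  have sub i : misses i phi \subset samples.
    by apply/subsetP => w; rewrite inE => /andP[].
  have p01 i : 0 <= (#|misses i phi|%:R / #|samples|%:R : rat) <= 1.
    rewrite divr_ge0 //= ler_pdivrMr // mul1r ler_nat subset_leq_card //.
  have -> : #|[set w in W | hits w phi]|%:R =
     #|W|%:R * \prod_i (1 - #|misses i phi|%:R / #|samples|%:R) :> rat.
    have -> : #|W|%:R = \prod_(i < k) #|samples|%:R :> rat.
      by rewrite prodr_const card_ord.
    rewrite -big_split /=.
    rewrite -(eq_card (A := family (fun i : 'I_k => mem (samples :\: misses i phi)))).
      rewrite card_family_rat; apply: eq_bigr => i _.
      rewrite cardsD (setIidPr (sub i)) natrB ?subset_leq_card //.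
      by field; rewrite gt_eqF.
    move=> w; rewrite !inE; apply/forallP/andP => [H|[/forallP H1 /forallP H2] i].
      by split; apply/forallP => i; have := H i; rewrite inE => /andP[].
    by rewrite inE H1 H2.
  rewrite -mulrA ler_piMr //.
  apply: le_trans (prod1B_mul1D_le1 (index_enum 'I_k) p01).
  apply: ler_wpM2l; last by rewrite lerD2l sum_miss_prob.
  by apply: prodr_ge0 => i _; rewrite subr_ge0; have /andP[] := p01 i.
have [w wW wX] : exists2 w, w \in W &
    #|[set phi in X | hits w phi]|%:R * (1 + gain) <= #|X|%:R.
  (* If every round were worse than claimed, summing over [W] would contradict [Hphi]. *)
  apply/exists_inP; apply: contraT => /exists_inPn H.
  have : \sum_(w in W) #|X|%:R <
      \sum_(w in W) #|[set phi in X | hits w phi]|%:R * (1 + gain).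
    apply: ltr_sum => [|w wW]; last by rewrite ltNge H.
    have /set0Pn[w wW] : W != set0.
      by rewrite -card_gt0 -(ltr0n rat) WE exprn_gt0.
    by apply/hasP; exists w => //; apply: mem_index_enum.
  rewrite ltNge -mulr_suml => /negP[].
  have -> : \sum_(w in W) #|[set phi in X | hits w phi]|%:R
      = \sum_(phi in X) #|[set w in W | hits w phi]|%:R :> rat.
    rewrite -!natr_sum; congr _%:R.
    under eq_bigr => w _ do rewrite -sum1dep_card big_mkcondr.
    rewrite exchange_big /=; apply: eq_bigr => phi _.
    by rewrite -big_mkcondr sum1dep_card.
  rewrite mulr_suml sumr_const.
  apply: le_trans (_ : \sum_(phi in X) #|W|%:R <= _); first exact: ler_sum.
  by rewrite sumr_const -!mulrnA mulnC.
by exists w; split => // i; move: wW; rewrite inE => /forallP.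
Qed.

Lemma exists_rounds n : exists s : seq {ffun 'I_k -> sample},
  [/\ size s = n,
      forall w : {ffun 'I_k -> sample}, w \in s -> forall i, w i \in samples &
    #|[set phi | all (hits^~ phi) s]|%:R * (1 + gain) ^+ n
      <= k%:R ^+ (q ^ k)].
Proof.
elim: n => [|n [s [sz sS sX]]].
  exists [::]; split => //; rewrite mulr1 -natrX ler_nat.
  by apply: leq_trans (max_card _) _; rewrite card_ffun card_ffun !card_ord.
have [w [wS wX]] := exists_round [set phi | all (hits^~ phi) s].
exists (w :: s); split => [|v|]; first by rewrite /= sz.
  by rewrite inE => /predU1P[->|/sS].
apply: le_trans sX; rewrite exprS mulrA.
apply: ler_wpM2r.
  by rewrite exprn_ge0 // addr_ge0 // divr_ge0 ?mulr_ge0 ?exprn_ge0 ?divr_ge0 // ltW.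
apply: le_trans wX; rewrite le_eqVlt; apply/orP; left; apply/eqP.
by congr (_%:R * _); apply: eq_card => phi; rewrite !inE /= andbC.
Qed.

(** After n rounds the bound on the number of surviving maps is below 1, so none survives. *)
Lemma exists_blocking_rounds n :
  4 * (q ^ k)%:R * (k%:R / (k%:R - 1)) ^+ r <= n%:R :> rat ->
  exists s : seq {ffun 'I_k -> sample},
  [/\ size s = n,
      forall w : {ffun 'I_k -> sample}, w \in s -> forall i, w i \in samples &
    forall phi, ~~ all (hits^~ phi) s].
Proof.
move=> nL; have [s [sz sS sX]] := exists_rounds n; exists s; split => // phi.
apply/negP => Hphi.
have t1 : 1 <= (k%:R / (k%:R - 1)) ^+ r :> rat.
  by rewrite exprn_ege1 // ler_pdivlMr // mul1r gerBl.
have Q0 : (0 < q ^ k)%N by rewrite expn_gt0 q_gt0.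
have := exp_lt_exp1D k Q0 t1 nL; rewrite ltNge => /negP; apply.
apply: le_trans sX; rewrite ler_peMl //.
  by rewrite exprn_ge0 // addr_ge0 // divr_ge0 ?mulr_ge0 ?exprn_ge0 ?divr_ge0 // ltW.
by rewrite ler1n card_gt0; apply/set0Pn; exists phi; rewrite inE.
Qed.

End Rounds.

(** * From blocking rounds to the choice number *)

(** Longer lists can be cut down to l colors, and separation passes to sublists. *)
Lemma sep_choosable_leq (G : sgraph) (s l l' : nat) : (l <= l')%N ->
  sep_choosable G s l -> sep_choosable G s l'.
Proof.
move=> ll' ch C L cardL sepL.
pose L' v := [set x in take l (enum (L v))].
have subL' v : L' v \subset L v.
  by apply/subsetP => x; rewrite inE => /mem_take; rewrite mem_enum.
have [||f [fL fadj]] := ch C L'.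
- move=> v; rewrite cardsE (card_uniqP _) ?take_uniq ?enum_uniq //.
  by rewrite size_takel // -cardE cardL.
- by move=> u v /sepL; apply: leq_trans; rewrite subset_leq_card // setISS.
- by exists f; split => // v; apply: (subsetP (subL' v)).
Qed.

Lemma not_sep_choosable0 (G : sgraph) (s : nat) : G -> ~ sep_choosable G s 0.
Proof.
move=> v ch; have [||f [fL _]] := ch unit (fun=> set0).
- by move=> u; rewrite cards0.
- by move=> u w _; rewrite set0I cards0.
- by have := fL v; rewrite inE.
Qed.

Lemma qceil_ge (k r : nat) : (1 < k)%N ->
  r%:R ^+ 2 <= (qceil k r)%:R * (k%:R - 1) / k%:R :> rat.
Proof.
move=> k1; have k0 : 0 < k%:R :> rat by rewrite ltr0n ltnW.
have k10 : 0 < k%:R - 1 :> rat by rewrite subr_gt0 ltr1n.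
rewrite /qceil natr_absz ger0_norm; last first.
  by rewrite ceil_ge0 (lt_le_trans (ltrN10 _)) // mulr_ge0 ?exprn_ge0 ?divr_ge0 // ltW.
set x : rat := _ * _ ^+ 2; apply: le_trans (_ : x * (k%:R - 1) / k%:R <= _).
  by rewrite /x le_eqVlt; apply/orP; left; apply/eqP; field; rewrite !gt_eqF.
by rewrite ler_wpM2r ?invr_ge0 ?(ltW k0) // ler_wpM2r ?(ltW k10) // ceil_ge.
Qed.

Lemma not_sep_choosable_multipartite (k r n : nat) (m : 'I_k -> nat) :
  (1 < k)%N -> (0 < r)%N -> (forall i, n <= m i)%N ->
  lower_bound k r <= n%:R ->
  ~ sep_choosable (complete_multipartite m) 1 r.
Proof.
move=> k1 r0 nm nL ch; set q := qceil k r.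
have qL := qceil_ge r k1.
have [|s [sz sS sN]] := exists_blocking_rounds k1 r0 qL (n := n).
  by rewrite natrX.
(* A default round: it supplies the lists of vertices whose index in their part is n or more. *)
have [w0 [w0S _]] := exists_round k1 r0 qL set0.
pose L (v : complete_multipartite m) : {set {ffun 'I_k -> 'I_q}} :=
  sample_list (tag v) (nth w0 s (tagged v) (tag v)).
have wS t i : nth w0 s t i \in samples k q r.
  by have [lt|ge] := ltnP t (size s); [apply/sS/mem_nth | rewrite nth_default].
have [||f [fL fadj]] := ch _ L.
- by move=> v; apply: card_sample_list.
- move=> u v; rewrite /adj /= /multipartite_adj neq_ltn => /orP[] lt.
    exact: sample_list_separated.
  by rewrite setIC; apply: sample_list_separated.
have i0 : 'I_k by exists 0; rewrite ltnW.
pose phi := [ffun c => if [pick v | f v == c] is Some v then tag v else i0].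
have phiE v : phi (f v) = tag v.
  rewrite ffunE; case: pickP => [u /eqP fu|/(_ v)]; last by rewrite eqxx.
  by apply/eqP; apply/negPn/negP => /fadj; rewrite fu eqxx.
have /negP[] := sN phi; apply/allP => w ws; apply/forallP => i.
(* The vertex of part i whose index is the position of w in [s] has the list given by [w i]. Its
   color is assigned to i, so [w i] does not miss [phi]. *)
have lt : (index w s < m i)%N by apply: leq_trans (nm i); rewrite -sz index_mem.
pose v : complete_multipartite m := Tagged (fun i => 'I_(m i)) (Ordinal lt).
have /imsetP[j _ fE] := fL v; rewrite /= nth_index // in fE.
rewrite inE; apply/negP => /andP[_ /forallP/(_ j)].
by rewrite -fE phiE eqxx.
Qed.

Theorem theorem8 (k : nat) (hk : (2 <= k)%N) (m : 'I_k -> nat)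
  (m_pos : forall i : 'I_k, (0 < m i)%N)
  (m_mono : forall i j : 'I_k, (i <= j)%N -> (m i <= m j)%N)
  (r : nat)
  (r_ok : lower_bound k r <= (m (Ordinal (ltnW hk)))%:R)
  (r_max : forall t : nat,
     lower_bound k t <= (m (Ordinal (ltnW hk)))%:R -> (t <= r)%N)
  (m_range : forall i : 'I_k,
     lower_bound k r <= (m i)%:R /\ (m i <= upper_bound k r i)%N) :
  (r < sep_choice_number (complete_multipartite m) 1)%N.
Proof.
rewrite /sep_choice_number; case: ex_minnP => l /boolp.asboolP ch _.
(* If the least l were at most r, the graph would also be choosable from separated lists of size
   r. *)
rewrite ltnNge; apply/negP => /sep_choosable_leq/(_ ch) {ch l}.
(* The random lists require [r > 0]; for [r = 0] any vertex has an empty list. *)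
have [->|r0] := posnP r.
  pose i0 := Ordinal (ltnW hk).
  exact: (not_sep_choosable0 (G := complete_multipartite m)
            (Tagged (fun i => 'I_(m i)) (Ordinal (m_pos i0)))).
by apply: not_sep_choosable_multipartite r_ok => // i; apply: m_mono.
Qed.
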